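(* Let $X,Y$ be Banach spaces and let $u:\mathbb{R}_{\ge 0}\to\mathcal{L}(X;Y)$ be a function. Then the following are equivalent: (a) for each $x\in X$ there is $t_x\ge 0$ such that the orbit $u_x$ is locally absolutely continuous on $(t_x,\infty)$; (b) there is $t\ge 0$ such that for all $x\in X$ the orbit $u_x$ is locally absolutely continuous on $(t,\infty)$.
   Context: $X,Y$ are Banach spaces over the same field $\mathbb{R}$ or $\mathbb{C}$; $\mathcal{L}(X;Y)$ is the space of bounded linear operators from $X$ to $Y$; $\mathbb{R}_{\ge 0}=[0,\infty)$. No continuity or other regularity of $u$ is assumed. For $x\in X$, the orbit is the function $u_x:\mathbb{R}_{\ge 0}\to Y$, $u_x(t)=u(t)x$. A function $f$ is absolutely continuous on an interval $J$ if for every $\varepsilon>0$ there is $\delta>0$ such that $\sum_{k=1}^l\|f(b_k)-f(a_k)\|<\varepsilon$ for every finite family of pairwise disjoint subintervals of $J$ with endpoints $a_k<b_k$ in $J$ ($k=1,\dots,l$) and $\sum_{k=1}^l(b_k-a_k)<\delta$. It is locally absolutely continuous on $J$ if it is absolutely continuous on every compact subinterval of $J$. *)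

(* Defs.v *)
From HB Require Import structures.
From mathcomp Require Import all_boot all_order all_algebra.
From mathcomp Require Import all_classical all_reals all_analysis.
From mathcomp Require Import complex.

Set Implicit Arguments.
Unset Strict Implicit.
Unset Printing Implicit Defensive.

Import Order.TTheory GRing.Theory Num.Theory.
Import numFieldNormedType.Exports.

Local Open Scope classical_set_scope.
Local Open Scope ring_scope.

Inductive scalar_kind := RealScalars | ComplexScalars.

Definition scalars (R : realType) (k : scalar_kind) : numFieldType :=
  match k with
  | RealScalars => R
  | ComplexScalars => R[i]
  end.

Record bounded_op (K : numFieldType) (X Y : normedModType K) := BoundedOp {
  linear_of_op :> {linear X -> Y};
  bounded_of_op : exists M : K, forall x : X,
    `|linear_of_op x| <= M * `|x| }.

Definition op_orbit (R : realType) (K : numFieldType) (X Y : normedModType K)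
    (u : {nonneg R} -> bounded_op X Y) (x : X) : {nonneg R} -> Y :=
  fun t => u t x.

(* Norms take values in K.  When K = R[i], [0 < e] forces e to be real and the
   sums of norms are real as well, so e ranges over the positive reals for either
   choice of scalars.

   The Booleans p and q say which endpoints belong to the subintervals: the k-th
   one may be open, closed or half-open.  It lies in J since J is convex and
   contains both of its endpoints. *)
Definition abs_continuous (R : realType) (K : numFieldType)
    (Y : normedModType K) (J : interval R) (f : {nonneg R} -> Y) : Prop :=
  forall e : K, 0 < e -> exists2 d : R, 0 < d &
    forall (l : nat) (a b : 'I_l -> {nonneg R}) (p q : 'I_l -> bool),
      (forall k, (a k)%:num \in J /\ (b k)%:num \in J) ->
      (forall k, (a k)%:num < (b k)%:num) ->
      trivIset setT (fun k =>
        [set` Interval (BSide (p k) (a k)%:num) (BSide (q k) (b k)%:num)]) ->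
      \sum_(k < l) ((b k)%:num - (a k)%:num) < d ->
      \sum_(k < l) `|f (b k) - f (a k)| < e.

Definition loc_abs_continuous (R : realType) (K : numFieldType)
    (Y : normedModType K) (J : interval R) (f : {nonneg R} -> Y) : Prop :=
  forall c d : R, c <= d -> `[c, d] `<=` [set` J] ->
    abs_continuous `[c, d] f.

(* Main.v *)
Require Import Defs.
From mathcomp Require Import all_boot all_order all_algebra.
From mathcomp Require Import all_classical all_reals all_analysis.
From mathcomp Require Import complex ring zify.

Set Implicit Arguments.
Unset Strict Implicit.
Unset Printing Implicit Defensive.

Import Order.TTheory GRing.Theory Num.Theory.
Import numFieldNormedType.Exports.
Local Open Scope classical_set_scope.
Local Open Scope ring_scope.

(** A Baire category argument.  For an interval J and a finite family of
    disjoint subintervals of J, the sum of the increments of the orbit of x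
    along the family is a continuous seminorm of x; x has an orbit absolutely
    continuous on J when these seminorms are uniformly small at x along the
    families of small total length.

    Let V n be the linear subspace of those x whose orbit is locally absolutely
    continuous on the reals above n; by hypothesis these subspaces cover X.
    Suppose some n is such that, for every compact interval J above n, there
    are d > 0 and a ball of X which is contained in the closure of V n and on
    which all seminorms of families of total length less than d are at most 1.
    The first inclusion makes V n dense.  The second gives, as in the
    uniform boundedness principle, a constant L such that these seminorms are
    all at most L * `|x|.  Hence absolute continuity on J passes from the dense
    subspace V n to X (abs_continuous_orbit_dense): an approximation error h
    costs at most L * `|h|, uniformly over the short families.  So n is a
    common threshold.

    If there were no such n, each n would have a compact interval I n above n
    violating the condition.  The closed sets C (n, j) of the points in the
    closure of V n at which every seminorm of a family in I n of length less
    than 1 / (j + 1) is at most 1 cover X: a point x of V n has an orbit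
    absolutely continuous on I n, and this gives j.  By Baire's theorem
    (closed_cover_ball) one of them contains a ball, a contradiction.

    Density of V n has to be obtained together with the bound: the bound
    alone yields only that orbits have bounded variation on J. *)

(** * Baire's theorem over real or complex scalars *)

(** The Archimedean property, in a form that makes sense in R[i], where the
    order is partial. *)
Definition small_inverses (K : numFieldType) : Prop :=
  forall e : K, 0 < e -> exists n : nat, n.+1%:R^-1 < e.

Lemma inverse_succ_anti (K : numFieldType) (m n : nat) :
  (m <= n)%N -> n.+1%:R^-1 <= m.+1%:R^-1 :> K.
Proof. by move=> mn; rewrite lef_pV2 ?posrE ?ltr0Sn// ler_nat. Qed.

Lemma inverse_succ_half (K : numFieldType) (m : nat) :
  (m.*2.+1).+1%:R^-1 + (m.*2.+1).+1%:R^-1 = m.+1%:R^-1 :> K.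
Proof.
have -> : (m.*2.+1).+1 = (2 * m.+1)%N by lia.
by rewrite natrM invfM -mulr2n -[LHS]mulr_natl mulrA divff ?pnatr_eq0// mul1r.
Qed.

(** Baire's theorem for a complete normed space over a possibly partially
    ordered field.  If no set of the cover contains a ball, then inside every
    closed ball there is a smaller one that misses any prescribed set of the
    cover; nesting such balls leads to a limit outside all of them.  All radii are inverses
    of positive integers, so that any two of them can be compared in K. *)
Lemma closed_cover_ball (K : numFieldType) (X : completeNormedModType K)
    (C : nat -> set X) :
  small_inverses K -> (forall n, closed (C n)) -> (forall x, exists n, C n x) ->
  exists (n : nat) (x : X) (m : nat),
    forall y, `|x - y| <= m.+1%:R^-1 -> C n y.
Proof.
move=> archK Ccl Ccov; apply: contrapT => noball.
have outside n x m : exists y, `|x - y| <= m.+1%:R^-1 /\ ~ C n y.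
  apply: contrapT => h; apply: noball; exists n, x, m => y xy.
  by apply: contrapT => Cy; apply: h; exists y.
have step (s : nat * (X * nat)) : exists t : X * nat,
    [/\ `|s.2.1 - t.1| + t.2.+1%:R^-1 <= s.2.2.+1%:R^-1, (s.1 <= t.2)%N &
        forall z, `|t.1 - z| <= t.2.+1%:R^-1 -> ~ C s.1 z].
  (* Half of the radius locates the new centre, the other half is room for the
     new ball. *)
  case: s => j [x m] /=; have [y [xy Cy]] := outside j x m.*2.+1.
  have : nbhs y (~` C j).
    by apply: open_nbhs_nbhs; split => //; exact: closed_openC.
  move=> /nbhs_normP[e /= e0 yC]; have [p pe] := archK e e0.
  exists (y, maxn m.*2.+1 (maxn j p)); split => /=.
  - rewrite -[leRHS]inverse_succ_half lerD// inverse_succ_anti//; lia.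
  - lia.
  - move=> z yz; apply: yC; rewrite /ball_/=; apply: le_lt_trans yz _.
    apply: le_lt_trans pe; apply: inverse_succ_anti; lia.
have [f fP] := choice step.
pose fix s n : X * nat := if n is p.+1 then f (p, s p) else (0, 0%N).
have sS n := fP (n, s n).
have nested n k : `|(s n).1 - (s (k + n)%N).1| + (s (k + n)%N).2.+1%:R^-1
    <= (s n).2.+1%:R^-1.
  elim: k => [|k IH]; first by rewrite subrr normr0 add0r.
  apply: le_trans IH; have [h _ _] := sS (k + n)%N.
  apply: le_trans (lerD (lexx _) h); rewrite addrA lerD2r.
  exact: ler_distD.
pose a n := (s n).1.
have near_a n k : `|a n - a (k + n)%N| <= (s n).2.+1%:R^-1.
  by apply: le_trans (nested n k); rewrite lerDl invr_ge0 ler0n.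
have : cvg (a @ \oo).
  apply: cauchy_cvg; apply: cauchy_exP => e e0.
  have [n ne] := archK e e0; exists (a n.+1).
  rewrite /fmapE -ball_normE; exists n.+1 => // m /= nm.
  rewrite /ball_/= -(subnK nm); apply: le_lt_trans ne.
  apply: le_trans (near_a _ _) _; apply: inverse_succ_anti.
  by have [] := sS n.
rewrite cvg_ex => -[l al].
have lin n : `|a n - l| <= (s n).2.+1%:R^-1.
  apply/ler_addgt0Pr => e e0.
  have /cvgrPdist_lt/(_ e e0)[N _ aN] := al.
  apply: le_trans (ler_distD (a (N + n)%N) _ _) _; apply: lerD.
    exact: near_a.
  by rewrite distrC ltW// aN//= leq_addr.
have [n Cl] := Ccov l; have [_ _ h] := sS n; exact: h (lin n.+1) Cl.
Qed.

(** A subspace is dense as soon as its closure contains a ball: approximate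
    both x0 and x0 + t *: x by the subspace, for a small t, then subtract and
    rescale. *)
Lemma ball_closure_dense (K : numFieldType) (X : normedModType K) (V : set X)
    (x0 : X) (r : K) :
  (forall v w, V v -> V w -> V (v - w)) -> (forall c v, V v -> V (c *: v)) ->
  0 < r -> (forall y, `|x0 - y| <= r -> closure V y) ->
  forall (x : X) (e : K), 0 < e -> exists2 v, V v & `|x - v| < e.
Proof.
move=> VB VZ r0 rV x e e0.
have x1 : 0 < `|x| + 1 by rewrite ltr_wpDl.
pose t := r / (`|x| + 1); have t0 : 0 < t by rewrite divr_gt0.
have te0 : 0 < t * e / 2 by rewrite !mulr_gt0// invr_gt0 ltr0n.
have approx y : `|x0 - y| <= r -> exists2 v, V v & `|y - v| < t * e / 2.
  move=> /rV/(_ (ball y (t * e / 2)) (nbhsx_ballx _ _ te0))[v [Vv]].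
  by rewrite -ball_normE; exists v.
have [|v Vv vy] := approx (x0 + t *: x).
  rewrite opprD addrA subrr add0r normrN normrZ gtr0_norm// /t mulrAC.
  by rewrite ler_pdivrMr// ler_wpM2l// ?ltW// ltrDl.
have [|w Vw wy] := approx x0; first by rewrite subrr normr0 ltW.
exists (t^-1 *: (v - w)); first by apply: VZ; apply: VB.
have -> : x - t^-1 *: (v - w) = t^-1 *: ((x0 + t *: x - v) - (x0 - w)).
  rewrite (_ : _ - _ - _ = t *: x - (v - w)).
    by rewrite [RHS]scalerBr scalerA mulVf ?gt_eqF// scale1r.
  rewrite !opprB [x0 + _]addrC -!addrA; congr (_ + _).
  by rewrite addrC -addrA subrK addrC.
rewrite normrZ gtr0_norm ?invr_gt0// mulrC ltr_pdivrMr// mulrC [X in _ < X]splitr.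
by apply: le_lt_trans (ler_normB _ _) _; rewrite ltrD.
Qed.

(** * Variation of orbits along finite families of intervals *)

Section OrbitVariation.

Context (R : realType) (K : numFieldType) (X Y : normedModType K).
Variable u : {nonneg R} -> bounded_op X Y.

Definition orbit_variation l (a b : 'I_l -> {nonneg R}) (x : X) : K :=
  \sum_(k < l) `|u (b k) x - u (a k) x|.

Definition fine_family (J : interval R) (d : R) l
    (a b : 'I_l -> {nonneg R}) : Prop :=
  exists p q : 'I_l -> bool,
    [/\ forall k, (a k)%:num \in J /\ (b k)%:num \in J,
        forall k, (a k)%:num < (b k)%:num,
        trivIset setT (fun k =>
          [set` Interval (BSide (p k) (a k)%:num) (BSide (q k) (b k)%:num)]) &
        \sum_(k < l) ((b k)%:num - (a k)%:num) < d].

Lemma abs_continuous_orbitE (J : interval R) (x : X) :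
  abs_continuous J (op_orbit u x) <->
  forall e : K, 0 < e -> exists2 d : R, 0 < d &
    forall l (a b : 'I_l -> {nonneg R}), fine_family J d a b ->
      orbit_variation a b x < e.
Proof.
split=> h e /h[d d0 hd]; exists d => // l a b.
  by move=> [p [q [? ? ? ?]]]; exact: (hd l a b p q).
by move=> p q ? ? ? ?; apply: hd; exists p, q.
Qed.

Lemma fine_family_le (J : interval R) (d d' : R) l (a b : 'I_l -> {nonneg R}) :
  d <= d' -> fine_family J d a b -> fine_family J d' a b.
Proof.
by move=> dd' [p [q [? ? ? sd]]]; exists p, q; split => //; apply: lt_le_trans dd'.
Qed.

Lemma orbit_variationD l (a b : 'I_l -> {nonneg R}) (x y : X) :
  orbit_variation a b (x + y) <= orbit_variation a b x + orbit_variation a b y.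
Proof.
rewrite -big_split; apply: ler_sum => k _ /=.
by rewrite (linearD (u (b k))) (linearD (u (a k))) opprD addrACA ler_normD.
Qed.

Lemma orbit_variationZ l (a b : 'I_l -> {nonneg R}) (c : K) (x : X) :
  orbit_variation a b (c *: x) = `|c| * orbit_variation a b x.
Proof.
rewrite mulr_sumr; apply: eq_bigr => k _.
by rewrite !linearZZ -scalerDr normrZ.
Qed.

Lemma orbit_variation_bounded l (a b : 'I_l -> {nonneg R}) :
  exists2 M : K, 0 <= M & forall x, orbit_variation a b x <= M * `|x|.
Proof.
have bnd t : exists M : K, 0 <= M /\ forall x, `|u t x| <= M * `|x|.
  have [M uM] := bounded_of_op (u t); exists `|M|; split => // x.
  (* M may fail to be real when X is trivial, hence its norm. *)
  have Mx : 0 <= M * `|x| := le_trans (normr_ge0 _) (uM x).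
  by rewrite -[`|x|]normr_id -normrM ger0_norm.
have [M /all_and2[M0 uM]] := choice bnd.
exists (\sum_(k < l) (M (b k) + M (a k))).
  by apply: sumr_ge0 => k _; rewrite addr_ge0.
move=> x; rewrite mulr_suml; apply: ler_sum => k _.
by apply: le_trans (ler_normB _ _) _; rewrite mulrDl lerD.
Qed.

Lemma abs_continuous_orbitB (J : interval R) (x y : X) :
  abs_continuous J (op_orbit u x) -> abs_continuous J (op_orbit u y) ->
  abs_continuous J (op_orbit u (x - y)).
Proof.
move=> /abs_continuous_orbitE xJ /abs_continuous_orbitE yJ.
apply/abs_continuous_orbitE => e e0.
have e2 : 0 < e / 2 by rewrite divr_gt0 ?ltr0n.
have [d d0 xd] := xJ _ e2; have [d' d'0 yd] := yJ _ e2.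
exists (Num.min d d'); first by rewrite lt_min d0.
move=> l a b abJ; apply: le_lt_trans (orbit_variationD _ _ _ _) _.
rewrite -scaleN1r orbit_variationZ normrN1 mul1r [ltRHS]splitr ltrD//.
  by apply: xd; apply: fine_family_le abJ; rewrite ge_min lexx.
by apply: yd; apply: fine_family_le abJ; rewrite ge_min lexx orbT.
Qed.

Lemma abs_continuous_orbitZ (J : interval R) (c : K) (x : X) :
  abs_continuous J (op_orbit u x) -> abs_continuous J (op_orbit u (c *: x)).
Proof.
move=> /abs_continuous_orbitE xJ; apply/abs_continuous_orbitE => e e0.
have c1 : 0 < `|c| + 1 by rewrite ltr_wpDl.
have [|d d0 xd] := xJ (e / (`|c| + 1)); first by rewrite divr_gt0.
exists d => // l a b /xd; rewrite orbit_variationZ ltr_pdivlMr// mulrC.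
by apply: le_lt_trans; rewrite ler_wpM2r ?lerDl//; exact: sumr_ge0.
Qed.

Definition variation_le1 (J : interval R) (d : R) : set X :=
  [set x | forall l (a b : 'I_l -> {nonneg R}), fine_family J d a b ->
             orbit_variation a b x <= 1].

(** This is an intersection of closed sets, one per family, since the variation
    along a fixed family is a bounded seminorm. *)
Lemma closed_variation_le1 (J : interval R) (d : R) :
  closed (variation_le1 J d).
Proof.
move=> y cly l a b abJ; apply/ler_addgt0Pr => e e0.
have [M M0 uM] := orbit_variation_bounded a b.
have M1 : 0 < M + 1 by rewrite ltr_wpDl.
have eM : 0 < e / (M + 1) by rewrite divr_gt0.
have [z [zJ]] := cly _ (nbhsx_ballx y _ eM).
rewrite -ball_normE /ball_/= ltr_pdivlMr// => yz.
rewrite -[y](subrK z) addrC; apply: le_trans (orbit_variationD _ _ _ _) _.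
apply: lerD; first exact: zJ.
apply: le_trans (uM _) _; rewrite mulrC; apply: le_trans (ltW yz).
by rewrite ler_wpM2l ?lerDl.
Qed.

(** The step of the uniform boundedness principle: the seminorms are at most 1
    on a ball around x0, hence at most 2 on the ball around 0 with the same
    radius, and homogeneity does the rest. *)
Lemma ball_variation_bound (J : interval R) (d : R) (x0 : X) (r : K) :
  0 < r -> (forall y, `|x0 - y| <= r -> variation_le1 J d y) ->
  forall l (a b : 'I_l -> {nonneg R}), fine_family J d a b ->
  forall y, orbit_variation a b y <= 2 / r * `|y|.
Proof.
move=> r0 rJ l a b abJ y.
have [->|y0] := eqVneq y 0.
  by rewrite -(scale0r 0) orbit_variationZ normr0 mul0r scale0r normr0 mulr0.
have ny : 0 < `|y| by rewrite normr_gt0.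
have t0 : 0 < r / `|y| by rewrite divr_gt0.
rewrite -(ler_pM2l t0) -[X in X * _ <= _](gtr0_norm t0) -orbit_variationZ.
have -> : r / `|y| * (2 / r * `|y|) = 1 + 1.
  by rewrite mulrACA; field; rewrite !gt_eqF.
rewrite -[X in orbit_variation _ _ X](subrK x0).
rewrite (_ : _ - x0 = (-1) *: (x0 - r / `|y| *: y)); last first.
  by rewrite scaleN1r opprB.
apply: le_trans (orbit_variationD _ _ _ _) _; apply: lerD.
  rewrite orbit_variationZ normrN1 mul1r; apply: rJ => //.
  by rewrite opprB addrC subrK normrZ gtr0_norm// divfK ?gt_eqF.
by apply: rJ => //; rewrite subrr normr0 ltW.
Qed.

(** Absolute continuity is preserved under approximation that is uniform in
    variation: write x as v + (x - v) with v in the dense set; the variation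
    of x - v is controlled by L, that of v by its absolute continuity. *)
Lemma abs_continuous_orbit_dense (J : interval R) (d : R) (L : K) :
  0 < d -> 0 < L ->
  (forall l (a b : 'I_l -> {nonneg R}), fine_family J d a b ->
     forall y, orbit_variation a b y <= L * `|y|) ->
  (forall x (e : K), 0 < e ->
     exists2 v, abs_continuous J (op_orbit u v) & `|x - v| < e) ->
  forall x, abs_continuous J (op_orbit u x).
Proof.
move=> d0 L0 uL dense x; apply/abs_continuous_orbitE => e e0.
have e2 : 0 < e / 2 by rewrite divr_gt0 ?ltr0n.
have [|v /abs_continuous_orbitE/(_ _ e2)[d' d'0 vd] xv] := dense x (e / 2 / L).
  by rewrite divr_gt0.
exists (Num.min d d'); first by rewrite lt_min d0.
move=> l a b abJ; rewrite -[x](subrK v) [ltRHS]splitr.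
apply: le_lt_trans (orbit_variationD _ _ _ _) _; apply: ltrD.
  apply: (@le_lt_trans _ _ (L * `|x - v|)).
    by apply: uL; apply: fine_family_le abJ; rewrite ge_min lexx.
  by rewrite mulrC -ltr_pdivlMr.
by apply: vd; apply: fine_family_le abJ; rewrite ge_min lexx orbT.
Qed.

End OrbitVariation.

(** * The common threshold *)

Lemma orbits_uniform_threshold (R : realType) (K : numFieldType)
    (X : completeNormedModType K) (Y : normedModType K)
    (u : {nonneg R} -> bounded_op X Y) :
  small_inverses K ->
  (forall x, exists tx : {nonneg R},
     loc_abs_continuous `]tx%:num, +oo[ (op_orbit u x)) ->
  exists t : {nonneg R}, forall x,
     loc_abs_continuous `]t%:num, +oo[ (op_orbit u x).
Proof.
move=> archK hu.
pose V n : set X :=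
  [set x | loc_abs_continuous `]n%:R, +oo[ (op_orbit u x)].
have Vcov x : exists n, V n x.
  have [t tx] := hu x; exists (Num.truncn t%:num).+1 => c d cd cdJ; apply: tx => //.
  move=> s /cdJ; rewrite /= !in_itv/= !andbT; apply: lt_trans.
  exact: truncnS_gt.
have VB n v w : V n v -> V n w -> V n (v - w).
  by move=> Vv Vw c d cd cdJ; apply: abs_continuous_orbitB; [exact: Vv|exact: Vw].
have VZ n c v : V n v -> V n (c *: v).
  by move=> Vv e d ed edJ; apply: abs_continuous_orbitZ; exact: Vv.
suff [n Hn] : exists n : nat, forall c d : R, c <= d ->
    `[c, d] `<=` [set` `]n%:R, +oo[] ->
    exists (j : nat) (x : X) (m : nat), forall y, `|x - y| <= m.+1%:R^-1 ->
      closure (V n) y /\ variation_le1 u `[c, d] j.+1%:R^-1 y.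
  exists n%:R%:nng => x c d cd cdn; have [j [x0 [m x0m]]] := Hn c d cd cdn.
  have m0 : 0 < m.+1%:R^-1 :> K by rewrite invr_gt0 ltr0n.
  apply: (@abs_continuous_orbit_dense _ _ _ _ u _ j.+1%:R^-1 (2 / m.+1%:R^-1)).
  - by rewrite invr_gt0 ltr0n.
  - by rewrite divr_gt0// ltr0n.
  - by apply: ball_variation_bound m0 _ => y /x0m[].
  - move=> y e e0; have [|v Vv yv] :=
      @ball_closure_dense _ _ (V n) x0 _ (VB n) (VZ n) m0 _ y e e0.
      by move=> z /x0m[].
    by exists v => //; apply: Vv.
apply: contrapT => none.
have bad n : exists cd : R * R, [/\ cd.1 <= cd.2,
    `[cd.1, cd.2] `<=` [set` `]n%:R, +oo[] &
    ~ exists (j : nat) (x : X) (m : nat), forall y, `|x - y| <= m.+1%:R^-1 ->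
      closure (V n) y /\ variation_le1 u `[cd.1, cd.2] j.+1%:R^-1 y].
  apply: contrapT => h; apply: none; exists n => c d cd cdn.
  by apply: contrapT => h'; apply: h; exists (c, d).
have [I IP] := choice bad.
(* For a fixed n, the interval I n is chosen before the length bound, whence
   the double index. *)
pose C p : set X := if unpickle p is Some (n, j) then
  closure (V n) `&` variation_le1 u `[(I n).1, (I n).2] j.+1%:R^-1 else set0.
have [||p [x0 [m x0m]]] := @closed_cover_ball K X C archK.
- move=> p; rewrite /C; case: unpickle => [[n j]|]; last exact: closed0.
  by apply: closedI; [exact: closed_closure|exact: closed_variation_le1].
- move=> x; have [n Vx] := Vcov x; have [Icd In _] := IP n.
  have /abs_continuous_orbitE/(_ 1 ltr01)[d d0 xd] := Vx _ _ Icd In.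
  exists (pickle (n, Num.truncn d^-1)); rewrite /C pickleK; split.
    exact: subset_closure.
  move=> l a b abI; apply/ltW/xd; apply: fine_family_le abI.
  by rewrite ltW// -ltf_pV2 ?posrE ?invrK ?truncnS_gt.
move: x0m; rewrite /C; case: unpickle => [[n j]|] x0m.
  by have [_ _ []] := IP n; exists j, x0, m.
by have := x0m x0; rewrite subrr normr0; apply.
Qed.

Lemma scalars_small_inverses (R : realType) (k : scalar_kind) :
  small_inverses (scalars R k).
Proof.
have smallR (e : R) : 0 < e -> exists n : nat, n.+1%:R^-1 < e.
  move=> e0; exists (Num.truncn e^-1).
  by rewrite -ltf_pV2 ?posrE ?invr_gt0// invrK truncnS_gt.
case: k => // -[e i]; rewrite ltcE /= => /andP[/eqP-> /smallR[n ne]].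
exists n; rewrite -(rmorph_nat (real_complex R)) -fmorphV.
by rewrite ltcE /= eqxx.
Qed.

Theorem proposition3p9 (R : realType) (k : scalar_kind)
    (X Y : completeNormedModType (scalars R k))
    (u : {nonneg R} -> bounded_op X Y) :
  (forall x : X, exists tx : {nonneg R},
     loc_abs_continuous `]tx%:num, +oo[ (op_orbit u x))
  <->
  (exists t : {nonneg R}, forall x : X,
     loc_abs_continuous `]t%:num, +oo[ (op_orbit u x)).
Proof.
split; last by move=> [t ut] x; exists t.
exact/orbits_uniform_threshold/scalars_small_inverses.
Qed.
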